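(* There exist $h_0,w_0$ such that for all integers $h\ge h_0$ and $w\ge w_0$, every $(1/101)$-dense partial Sudoku of type $(h,w)$ has a fractional completion.
   Context: Let $h,w\ge 2$ be integers and $n=hw$. Rows, columns and symbols are indexed by $[n]=\{1,\dots,n\}$. For a cell $(i,j)\in[n]^2$ put $\mathrm{box}(i,j)=h\lfloor (i-1)/h\rfloor+\lfloor (j-1)/w\rfloor+1\in[n]$; the $n$ sets $\mathrm{box}^{-1}(\ell)$ are the boxes (each an $h\times w$ subarray). A row bundle is a set of $h$ consecutive rows $\{hp+1,\dots,h(p+1)\}$ ($0\le p<w$); a column bundle is a set of $w$ consecutive columns $\{wq+1,\dots,w(q+1)\}$ ($0\le q<h$). A partial Sudoku of type $(h,w)$ is an $n\times n$ array whose cells are empty or contain a symbol of $[n]$, such that each symbol appears at most once in every row, every column and every box. Represent it by $f_P:[n]^3\to\{0,1\}$, where $f_P(i,j,k)=1$ iff symbol $k$ is in cell $(i,j)$. A fractional completion is a function $f:[n]^3\to[0,1]$ such that $f_P(i,j,k)=1$ implies $f(i,j,k)=1$, and for all $i,j,k,\ell\in[n]$: $\sum_{i'} f(i',j,k)=\sum_{j'} f(i,j',k)=\sum_{k'} f(i,j,k')=1$ and $\sum_{(i',j'):\mathrm{box}(i',j')=\ell} f(i',j',k)=1$. A partial Sudoku of type $(h,w)$ is $\epsilon$-dense if each row, each column and each box has at most $\epsilon n$ filled cells, and each symbol occurs at most $\epsilon h$ times within any row bundle and at most $\epsilon w$ times within any column bundle. *)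

(* Defs.v *)
From mathcomp Require Import all_boot all_order all_algebra.
From mathcomp Require Import reals.

Set Implicit Arguments.
Unset Strict Implicit.
Unset Printing Implicit Defensive.

Import Order.TTheory GRing.Theory Num.Theory.

Local Open Scope ring_scope.

(** Rows, columns, symbols and boxes are indexed from 0, by ['I_(h * w)].
    Row [i] lies in row bundle [i %/ h] (there are [w] of these) and column [j]
    in column bundle [j %/ w] (there are [h] of these), so a box is an [h] by
    [w] subarray and [box h w i j < h * w] whenever [i, j < h * w]. *)
Definition box (h w i j : nat) : nat := (h * (i %/ h) + j %/ w)%N.

Definition array (h w : nat) : Type :=
  'I_(h * w) -> 'I_(h * w) -> option 'I_(h * w).

Definition partial_sudoku (h w : nat) (P : array h w) : Prop :=
  [/\ forall i k : 'I_(h * w), (#|[set j | P i j == Some k]| <= 1)%N,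
      forall j k : 'I_(h * w), (#|[set i | P i j == Some k]| <= 1)%N
    & forall l k : 'I_(h * w),
        (#|[set c : 'I_(h * w) * 'I_(h * w) |
             (box h w c.1 c.2 == l) && (P c.1 c.2 == Some k)]| <= 1)%N].

(** The 0/1-valued function representing [P], with values in [bool]. *)
Definition sudoku_fun (h w : nat) (P : array h w)
  (i j k : 'I_(h * w)) : bool := P i j == Some k.

Definition fractional_completion (R : realType) (h w : nat) (P : array h w)
    (f : 'I_(h * w) -> 'I_(h * w) -> 'I_(h * w) -> R) : Prop :=
  [/\ forall i j k, 0 <= f i j k <= 1,
      forall i j k, sudoku_fun P i j k -> f i j k = 1,
      [/\ forall j k, \sum_(i < h * w) f i j k = 1,
          forall i k, \sum_(j < h * w) f i j k = 1
        & forall i j, \sum_(k < h * w) f i j k = 1]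
    & forall l k : 'I_(h * w),
        \sum_(c : 'I_(h * w) * 'I_(h * w) | box h w c.1 c.2 == l)
          f c.1 c.2 k = 1].

Definition dense_sudoku (R : realType) (eps : R) (h w : nat) (P : array h w) : Prop :=
  [/\ forall i : 'I_(h * w),
        #|[set j | P i j != None]|%:R <= eps * (h * w)%:R,
      forall j : 'I_(h * w),
        #|[set i | P i j != None]|%:R <= eps * (h * w)%:R,
      forall l : 'I_(h * w),
        #|[set c : 'I_(h * w) * 'I_(h * w) |
            (box h w c.1 c.2 == l) && (P c.1 c.2 != None)]|%:R
          <= eps * (h * w)%:R,
      forall (p : 'I_w) (k : 'I_(h * w)),
        #|[set c : 'I_(h * w) * 'I_(h * w) |
            (c.1 %/ h == p)%N && (P c.1 c.2 == Some k)]|%:R <= eps * h%:R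
    & forall (q : 'I_h) (k : 'I_(h * w)),
        #|[set c : 'I_(h * w) * 'I_(h * w) |
            (c.2 %/ w == q)%N && (P c.1 c.2 == Some k)]|%:R <= eps * w%:R].

(* Main.v *)
(** Each of the four families of constraints (cell, row-symbol, column-symbol,
    box-symbol) partitions the triples [(i, j, k)] into classes of size [n];
    let [E_a] be averaging over the classes of family [a].  These idempotents
    commute, since [#{t' : t' ~a t, t' ~b s}] is symmetric in [t] and [s].
    Hence [Pi = 1 - \prod_a (1 - E_a)] satisfies [E_a Pi = E_a], and [|Pi u|]
    is at most [2^4 - 1 = 15] times the largest of the [|E_a u|].

    A triple is available when no class containing it is met by the filled
    triples.  Starting from [1/n] on the available triples, we need a
    correction [u], cut off to the available triples, that repairs the class
    sums.  It is a solution of [u - Pi (u 1_unavailable) = Pi v], where [v] is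
    the defect of the starting point, in the space of those [u] with sum 0 on
    every class met by a filled triple.  By density a class that is not met
    contains at most [3 n / 101] unavailable triples, so on that space
    [u |-> Pi (u 1_unavailable)] has sup norm at most [15 * 3 / 101 < 1 / 2].
    So the equation is solvable with [|u| <= 1/n], and the corrected function
    is nonnegative. *)

From HB Require Import structures.
Require Import Defs.
From mathcomp Require Import all_boot all_order all_algebra.
From mathcomp Require Import reals.
From mathcomp Require Import ring lra.

Set Implicit Arguments.
Unset Strict Implicit.
Unset Printing Implicit Defensive.

Import Order.TTheory GRing.Theory Num.Theory.
Local Open Scope ring_scope.

(** * Solvability of linear equations on a kernel, sup norm and union bound *)

Lemma linear_solve_in_kernel (F : fieldType) (V W : vectType F)
    (L : {linear V -> V}) (Z : {linear V -> W}) :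
  (forall u, Z u = 0 -> Z (L u) = 0) ->
  (forall u, Z u = 0 -> L u = 0 -> u = 0) ->
  forall v, Z v = 0 -> exists2 u, Z u = 0 & L u = v.
Proof.
move=> stabL injL v Zv0.
pose Y := lker (linfun Z).
have inY x : (x \in Y) = (Z x == 0) by rewrite memv_ker lfunE.
have sub : (linfun L @: Y <= Y)%VS.
  apply/subvP => y /memv_imgP [x]; rewrite !inY => /eqP Zx ->.
  by rewrite lfunE stabL.
(* [L] is injective on the finite-dimensional space [Y], so the image of [Y], which lies in [Y], has
   the same dimension and is all of it. *)
have /eqP eqY : (linfun L @: Y == Y)%VS.
  rewrite eqEdim sub /= limg_dim_eq //.
  apply/eqP; rewrite -subv0; apply/subvP => x; rewrite memv_cap inY memv_ker lfunE.
  by case/andP => /eqP Zx /eqP Lx; rewrite (injL x) ?mem0v.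
have : v \in (linfun L @: Y)%VS by rewrite eqY inY Zv0.
case/memv_imgP => u; rewrite inY lfunE => /eqP Zu ->.
by exists u.
Qed.

(** Taking [M] to be the maximum of [|u|], attained because [T] is finite, gives [M <= k * M + c],
    and [k * M] can be absorbed on the left. With [c = 0] this yields [u = 0]. *)
Lemma sup_bound_absorb {R : realFieldType} {T : finType} (u : T -> R) (k c : R) :
  k < 1 ->
  (forall M, 0 <= M -> (forall t, `|u t| <= M) -> forall t, `|u t| <= k * M + c) ->
  forall t, `|u t| <= c / (1 - k).
Proof.
move=> k1 H t0.
pose tm := [arg max_(t > t0) `|u t|]%O.
have tmP t : `|u t| <= `|u tm|.
  by rewrite /tm; case: arg_maxP => // i _; apply.
apply: le_trans (tmP t0) _.
rewrite ler_pdivlMr ?subr_gt0 //.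
have := H _ (normr_ge0 _) tmP tm.
lra.
Qed.

Lemma card_bigcup_leq (T J : finType) (r : seq J) (D : pred J) (F : J -> {set T}) :
  (#|\bigcup_(j <- r | D j) F j| <= \sum_(j <- r | D j) #|F j|)%N.
Proof.
apply: (big_ind2 (fun (A : {set T}) m => (#|A| <= m)%N)) => [|A m B m' HA HB|//].
  by rewrite cards0.
by apply: leq_trans (leq_add HA HB); rewrite leq_card_setU.
Qed.

(** * Commuting averaging operators *)

Section ClassAverage.
Variables (R : realFieldType) (T I : finType) (K : eqType).
Variables (key : I -> T -> K) (n : nat).
Implicit Types (a b : I) (t s : T) (u v : {ffun T -> R^o}).

Definition key_meet a b t s : nat :=
  #|[set t' | (key a t' == key a t) && (key b t' == key b s)]|.

Lemma key_meetC a b t s : key_meet a b t s = key_meet b a s t.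
Proof. by rewrite /key_meet; apply: eq_card => x; rewrite !inE andbC. Qed.

(** This is [E_a], the classes being the fibres of [key a]; the uniform factor [1/n] makes it an
    average once [card_class] is assumed. Values in [R^o] turn functions into a vector space over
    [R]. *)
Definition class_avg a u : {ffun T -> R^o} :=
  [ffun t => n%:R^-1 * \sum_(t' | key a t' == key a t) u t'].

Lemma class_avg_is_linear a : linear (class_avg a).
Proof.
move=> c u v; apply/ffunP => t; rewrite !ffunE.
under eq_bigr do rewrite !ffunE.
rewrite big_split /= -scaler_sumr /GRing.scale /=; ring.
Qed.

HB.instance Definition _ a :=
  GRing.isLinear.Build R {ffun T -> R^o} {ffun T -> R^o} _ (class_avg a)
    (class_avg_is_linear a).

Hypothesis n_gt0 : (0 < n)%N.
Hypothesis card_class : forall a t, #|[set t' | key a t' == key a t]| = n.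
Hypothesis key_meet_sym : forall a b t s, key_meet a b t s = key_meet a b s t.

Let n_neq0 : n%:R != 0 :> R.
Proof. by rewrite pnatr_eq0 -lt0n. Qed.

Lemma class_avg_eq a u t s : key a t = key a s -> class_avg a u t = class_avg a u s.
Proof. by move=> e; rewrite !ffunE e. Qed.

Lemma class_sum_const a t (x : R) :
  \sum_(t' | key a t' == key a t) x = n%:R * x.
Proof. by rewrite sumr_const -(card_class a t) cardsE mulr_natl. Qed.

Lemma class_avg_idem a u : class_avg a (class_avg a u) = class_avg a u.
Proof.
apply/ffunP => t; rewrite ffunE.
rewrite (eq_bigr (fun=> class_avg a u t)); last first.
  by move=> s /eqP e; apply: class_avg_eq.
by rewrite class_sum_const mulKf.
Qed.

(** Exhibits the kernel of [E_a E_b] as [key_meet a b t s / n^2]. Exchanging [a] and [b] transposes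
    this kernel, so its symmetry in [t] and [s] is what makes the averages commute. *)
Lemma class_avg_comp a b u t :
  class_avg a (class_avg b u) t =
  n%:R^-1 * (n%:R^-1 * \sum_s (key_meet a b t s)%:R * u s).
Proof.
rewrite ffunE; congr (_ * _).
under eq_bigr do rewrite ffunE.
rewrite -mulr_sumr; congr (_ * _).
under eq_bigr do rewrite big_mkcond.
rewrite exchange_big /=; apply: eq_bigr => s _.
rewrite -big_mkcondr /= sumr_const /key_meet cardsE mulr_natl; congr (_ *+ _).
by apply: eq_card => x; rewrite [RHS]inE unfold_in (eq_sym (key b s)).
Qed.

Lemma class_avgC a b u : class_avg a (class_avg b u) = class_avg b (class_avg a u).
Proof.
apply/ffunP => t; rewrite !class_avg_comp; congr (_ * (_ * _)).
by apply: eq_bigr => s _; rewrite key_meet_sym key_meetC.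
Qed.

Lemma class_avg_bound a u t (c : R) :
  (forall s, `|u s| <= c) -> `|class_avg a u t| <= c.
Proof.
move=> H; rewrite ffunE normrM ger0_norm ?invr_ge0 ?ler0n //.
rewrite ler_pdivrMl ?ltr0n // -(class_sum_const a t).
by apply: le_trans (ler_norm_sum _ _ _) _; apply: ler_sum.
Qed.

(** The product of the operators [1 - E_a] for [a] in [r]; thus [avg_proj] is [Pi] when [r]
    enumerates all families. *)
Fixpoint avg_residue (r : seq I) u : {ffun T -> R^o} :=
  if r is a :: r' then avg_residue r' u - class_avg a (avg_residue r' u) else u.

Definition avg_proj r u := u - avg_residue r u.

Lemma avg_residue_is_linear r : linear (avg_residue r).
Proof.
move=> c u v; elim: r => //= a r ->.
rewrite linearP scalerBr opprD !addrA; congr (_ - _).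
by rewrite -!addrA; congr (_ + _); rewrite addrC.
Qed.

HB.instance Definition _ r :=
  GRing.isLinear.Build R {ffun T -> R^o} {ffun T -> R^o} _ (avg_residue r)
    (avg_residue_is_linear r).

(** By commutation [E_a] can be moved next to its own factor, and [E_a (1 - E_a) = 0] by
    idempotence. *)
Lemma class_avg_residue a r u : a \in r -> class_avg a (avg_residue r u) = 0.
Proof.
have comm q : class_avg a (avg_residue q u) = avg_residue q (class_avg a u).
  by elim: q => //= b q IH; rewrite linearB /= class_avgC IH.
elim: r => //= b r IH; rewrite inE linearB /= => /predU1P [<-|/IH Hr].
  by rewrite class_avg_idem subrr.
by rewrite class_avgC Hr linear0 subrr.
Qed.

Lemma class_avg_proj a r u : a \in r -> class_avg a (avg_proj r u) = class_avg a u.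
Proof. by move=> ar; rewrite linearB /= class_avg_residue // subr0. Qed.

(** Adding a family replaces [Pi_r] by [Pi_r + E_a - E_a Pi_r]. As [E_a] does not increase the sup
    norm, a bound [B] becomes [2 B + c], and starting from 0 this gives [(2 ^ size r - 1) c]. Only
    the averages of [u] enter, not [u] itself. *)
Lemma avg_proj_bound r u (c : R) :
  (forall a t, `|class_avg a u t| <= c) ->
  forall t, `|avg_proj r u t| <= (2 ^ size r)%:R * c - c.
Proof.
move=> H; elim: r => [|a r IH] t.
  by rewrite /avg_proj subrr ffunE normr0 expn0 mul1r subrr.
have -> : avg_proj (a :: r) u t =
    avg_proj r u t + (class_avg a u t - class_avg a (avg_proj r u) t).
  rewrite {1 3}/avg_proj
    (_ : class_avg a (u - _) = class_avg a u - class_avg a (avg_residue r u)).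
    rewrite /avg_proj /=; move: (class_avg a u) (class_avg a _) (avg_residue r u) => x y z.
    by rewrite !ffunE; ring.
  exact: linearB.
have b1 := IH t; have b2 := H a t; have b3 := class_avg_bound a t IH.
rewrite /= expnS natrM.
apply: le_trans (ler_normD _ _) _.
have := ler_normB (class_avg a u t) (class_avg a (avg_proj r u) t).
lra.
Qed.
End ClassAverage.

(** * Extending a sparse set [P] to a weight with all class sums 1 *)

Section FractionalCover.
Variables (R : realFieldType) (T I : finType) (K : eqType).
Variables (key : I -> T -> K) (n : nat) (P : {set T}) (eps : R).
Implicit Types (a b : I) (t s : T).

Hypothesis n_gt0 : (0 < n)%N.
Hypothesis card_class : forall a t, #|[set t' | key a t' == key a t]| = n.
Hypothesis key_meet_sym :
  forall a b t s, key_meet key a b t s = key_meet key a b s t.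
Hypothesis class_P_le1 : forall a t, (#|[set s in P | key a s == key a t]| <= 1)%N.
Hypothesis P_sparse : forall a b t, a != b ->
  (\sum_(s in P) key_meet key a b t s)%:R <= eps * n%:R.

Let n_neq0 : n%:R != 0 :> R.
Proof. by rewrite pnatr_eq0 -lt0n. Qed.

Local Notation avg := (@class_avg R T I K key n).

Definition covered a t := [exists s in P, key a s == key a t].
Definition available t := [forall a, ~~ covered a t].

Lemma covered_key a t s : key a t = key a s -> covered a t = covered a s.
Proof. by move=> e; rewrite /covered e. Qed.

Lemma covered_card a t : #|[set s in P | key a s == key a t]| = covered a t.
Proof.
have := class_P_le1 a t; rewrite leq_eqVlt ltnS leqn0.
case: (boolP (covered a t)) => [/existsP [s /andP [sP es]]|nc].
  by case/predU1P=> // /eqP /cards0_eq /setP /(_ s); rewrite !inE sP es.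
move=> _; apply/eqP; rewrite cards_eq0; apply/eqP/setP => s; rewrite !inE.
by apply/negP => H; move/negP: nc; apply; apply/existsP; exists s.
Qed.

Lemma card_unavailable a t : ~~ covered a t ->
  #|[set s | (key a s == key a t) && ~~ available s]|%:R <=
    (#|I|.-1)%:R * (eps * n%:R).
Proof.
move=> nc.
have le : (#|[set s | (key a s == key a t) && ~~ available s]| <=
   \sum_(b | b != a) \sum_(s in P) key_meet key a b t s)%N.
  apply: (@leq_trans #|\bigcup_(b | b != a) \bigcup_(s in P)
     [set t' | (key a t' == key a t) && (key b t' == key b s)]|).
    apply: subset_leq_card; apply/subsetP => s; rewrite !inE.
    case/andP => es /forallPn [b]; rewrite negbK => cb.
    have ba : b != a.
      by apply: contraNneq nc => e; rewrite -(covered_key (eqP es)) -e.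
    case/existsP: cb => p /andP [pP ep].
    apply/bigcupP; exists b => //; apply/bigcupP; exists p => //.
    by rewrite inE es eq_sym ep.
  apply: leq_trans (card_bigcup_leq _ _ _) _; apply: leq_sum => b _.
  exact: card_bigcup_leq.
move: le; rewrite -(ler_nat R) => /le_trans; apply.
rewrite natr_sum.
apply: (@le_trans _ _ (\sum_(b | b != a) eps * n%:R)).
  by apply: ler_sum => b ba; apply: P_sparse; rewrite eq_sym.
rewrite sumr_const mulr_natl.
by rewrite (cardC1 a).
Qed.

Hypothesis I_gt0 : (0 < #|I|)%N.
Hypothesis eps_ge0 : 0 <= eps.
Hypothesis eps_small : 2 * ((2 ^ #|I|)%:R - 1) * (#|I|.-1)%:R * eps <= 1.


Let V := {ffun T -> R^o}.
Let kappa : R := ((2 ^ #|I|)%:R - 1) * (#|I|.-1)%:R * eps.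

Definition mask (u : V) : V := [ffun t => if available t then 0 else u t].

(** Its kernel is the space in which the equation is solved: sum 0 on each class meeting [P]. The
    default 0 imposes nothing on the other classes. *)
Definition covered_avg (u : V) : {ffun I * T -> R^o} :=
  [ffun x => if covered x.1 x.2 then avg x.1 u x.2 else 0].

Definition avg_step (u : V) : V := u - avg_proj key n (enum I) (mask u).

Lemma mask_is_linear : linear mask.
Proof.
move=> c u v; apply/ffunP => t; rewrite !ffunE; case: ifP => // _.
by rewrite scaler0 addr0.
Qed.

HB.instance Definition _ := GRing.isLinear.Build R V V _ mask mask_is_linear.

Lemma covered_avg_is_linear : linear covered_avg.
Proof.
move=> c u v; apply/ffunP => x; rewrite [LHS]ffunE linearP !ffunE.
by case: ifP => // _; rewrite scaler0 addr0.
Qed.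

HB.instance Definition _ :=
  GRing.isLinear.Build R V {ffun I * T -> R^o} _ covered_avg covered_avg_is_linear.

Lemma avg_step_is_linear : linear avg_step.
Proof.
move=> c u v; rewrite /avg_step /avg_proj !linearP /=.
move: (avg_residue _ _ _ _) (avg_residue _ _ _ _) => x y.
by apply/ffunP => t; rewrite !ffunE /GRing.scale /=; ring.
Qed.

HB.instance Definition _ := GRing.isLinear.Build R V V _ avg_step avg_step_is_linear.

Let avg_projE a (u : V) : avg a (avg_proj key n (enum I) u) = avg a u.
Proof. by rewrite class_avg_proj ?mem_enum. Qed.

(** A covered class contains no available element, so masking leaves it unchanged. *)
Lemma avg_mask_covered a t (u : V) : covered a t -> avg a (mask u) t = avg a u t.
Proof.
move=> cov; rewrite [LHS]ffunE [RHS]ffunE; congr (_ * _).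
apply: eq_bigr => s /eqP e; rewrite ffunE; case: ifP => // /forallP /(_ a).
by rewrite (covered_key e) cov.
Qed.

(** An uncovered class contains no element of [P], so a bound on [u] outside [P] suffices. This
    matters for the defect [v] below, which is of order 1 on [P] but [1/n] elsewhere. *)
Lemma avg_mask_bound a t (u : V) (M : R) : 0 <= M -> ~~ covered a t ->
  (forall s, s \notin P -> `|u s| <= M) ->
  `|avg a (mask u) t| <= (#|I|.-1)%:R * eps * M.
Proof.
move=> M0 nc uM; rewrite ffunE normrM ger0_norm ?invr_ge0 ?ler0n //.
rewrite ler_pdivrMl ?ltr0n //.
apply: le_trans (ler_norm_sum _ _ _) _.
have H := ler_wpM2r M0 (card_unavailable nc).
have -> : n%:R * ((#|I|.-1)%:R * eps * M) = (#|I|.-1)%:R * (eps * n%:R) * M by ring.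
apply: le_trans H.
rewrite mulr_natl -sumr_const big_mkcond [leRHS]big_mkcond /=.
apply: ler_sum => s _; rewrite inE ffunE.
case: eqP => //= es; case: ifP => /= _; first by rewrite normr0.
apply: uM; apply: contra nc => sP.
by apply/existsP; exists s; rewrite sP es eqxx.
Qed.

Lemma covered_avg_eq0 (u : V) :
  covered_avg u = 0 <-> forall a t, covered a t -> avg a u t = 0.
Proof.
split=> [/ffunP H a t ca|H].
  by have := H (a, t); rewrite ffunE /= ca => ->; rewrite ffunE.
by apply/ffunP => -[a t]; rewrite ffunE [RHS]ffunE /=; case: ifP => // /H.
Qed.

(** The averages of [mask u] vanish on covered classes and are small on uncovered ones by sparsity;
    [avg_proj_bound] then costs the factor [2 ^ #|I| - 1]. *)
Lemma avg_proj_mask_bound (u : V) (M : R) : 0 <= M -> covered_avg (mask u) = 0 ->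
  (forall s, s \notin P -> `|u s| <= M) ->
  forall t, `|avg_proj key n (enum I) (mask u) t| <= kappa * M.
Proof.
move=> M0 /covered_avg_eq0 c0 uM t.
have /(_ _ t) H := avg_proj_bound n_gt0 card_class (enum I) (u := mask u)
  (c := (#|I|.-1)%:R * eps * M).
apply: le_trans (H _) _; last by rewrite -cardE /kappa -subr_ge0; lra.
move=> a s; case: (boolP (covered a s)) => [cas|nc]; last exact: avg_mask_bound.
by rewrite c0 // normr0 !mulr_ge0 ?ler0n.
Qed.

Lemma fractional_cover : exists f : T -> R,
  [/\ forall t, 0 <= f t, forall t, t \in P -> f t = 1
    & forall a t, \sum_(t' | key a t' == key a t) f t' = 1].
Proof.
have kappa_half : kappa <= 1 / 2 by move: eps_small; rewrite /kappa; lra.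
have kappa_lt1 : kappa < 1 by lra.
have mask0 u : covered_avg u = 0 -> covered_avg (mask u) = 0.
  move=> /covered_avg_eq0 u0; apply/covered_avg_eq0 => a t cat.
  by rewrite avg_mask_covered // u0.
have proj0 u : covered_avg u = 0 ->
    covered_avg (avg_proj key n (enum I) (mask u)) = 0.
  move=> /mask0 /covered_avg_eq0 u0; apply/covered_avg_eq0 => a t cat.
  by rewrite avg_projE u0.
have stab u : covered_avg u = 0 -> covered_avg (avg_step u) = 0.
  by move=> u0; rewrite linearB /= u0 proj0 // subrr.
(* A solution of the homogeneous equation satisfies [|u| <= kappa * max |u|] with [kappa < 1], hence
   vanishes. *)
have inj u : covered_avg u = 0 -> avg_step u = 0 -> u = 0.
  move=> u0 /eqP; rewrite subr_eq0 => /eqP eu.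
  have := @sup_bound_absorb _ _ u kappa 0 kappa_lt1.
  rewrite mul0r => H; apply/ffunP => t; rewrite [RHS]ffunE; apply/eqP; rewrite -normr_le0.
  apply: H => M M0 uM s; rewrite addr0 eu.
  by apply: avg_proj_mask_bound => //; apply: mask0.
(* On a covered class the [n] terms [1/n] sum to 1, and exactly one element of [P] is subtracted, so
   [v] has sum 0 there. *)
pose v : V := [ffun t => n%:R^-1 - (t \in P)%:R].
have v0 : covered_avg v = 0.
  apply/covered_avg_eq0 => a t cat; rewrite ffunE.
  under eq_bigr do rewrite ffunE.
  rewrite sumrB (class_sum_const card_class) mulfV //.
  rewrite -natr_sum -big_mkcondr /= sum1dep_card.
  rewrite (eq_card (B := [set s in P | key a s == key a t])); last first.
    by move=> s; rewrite !inE andbC.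
  by rewrite covered_card cat subrr mulr0.
have [u u0 eu] := linear_solve_in_kernel stab inj (proj0 _ v0).
rewrite /= /avg_step in eu.
have v_le t : t \notin P -> `|v t| <= n%:R^-1.
  by move=> /negbTE tP; rewrite ffunE tP subr0 ger0_norm // invr_ge0 ler0n.
(* The equation gives [|u| <= kappa * max |u| + kappa / n], so [|u| <= kappa / (1 - kappa) / n],
   which is at most [1/n] because [kappa <= 1/2]. *)
have u_le t : `|u t| <= n%:R^-1.
  apply: le_trans (sup_bound_absorb (c := kappa * n%:R^-1) kappa_lt1 _ t) _.
    move=> M M0 uM s.
    have -> : u s = avg_proj key n (enum I) (mask u) s + avg_proj key n (enum I) (mask v) s.
      by rewrite -eu; move: (avg_proj _ _ _ _) => x; rewrite !ffunE addrC subrK.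
    apply: le_trans (ler_normD _ _) _; apply: lerD.
      by apply: avg_proj_mask_bound => //; apply: mask0.
    by apply: avg_proj_mask_bound => //; [rewrite invr_ge0 ler0n|apply: mask0].
  rewrite ler_pdivrMr ?subr_gt0 // [leRHS]mulrC ler_wpM2r ?invr_ge0 ?ler0n //.
  lra.
(* Equal to [1/n + u] on available elements and to the indicator of [P] elsewhere; this form makes
   the averages computable by linearity. *)
pose f : V := [ffun=> n%:R^-1] - mask v + (u - mask u).
have fE t : f t = if available t then n%:R^-1 + u t else (t \in P)%:R.
  rewrite !ffunE; case: ifP => _; ring.
exists f; split=> [t|t tP|a t].
- rewrite fE; case: ifP => _; last by case: (t \in P); rewrite ?ler01.
  have := u_le t; rewrite ler_norml => /andP []; lra.
- rewrite fE tP ifF //; apply/forallP => H.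
  have /card_gt0P [a _] := I_gt0.
  by move: (H a) => /existsP; apply; exists t; rewrite tP eqxx.
have -> : \sum_(t' | key a t' == key a t) f t' = n%:R * avg a f t.
  by rewrite ffunE mulVKf.
have -> : avg a f = avg a [ffun=> n%:R^-1].
  (* As [E_a Pi = E_a], the equation says that [u - mask u] and [mask v] have equal averages, so the
     two corrections in [f] cancel. *)
  have /(congr1 (avg a)) := eu.
  rewrite linearB /= !avg_projE => eau.
  by rewrite linearD linearB linearB /= eau subrK.
rewrite ffunE; under eq_bigr do rewrite ffunE.
by rewrite (class_sum_const card_class) mulVKf // mulfV.
Qed.
End FractionalCover.

(** * Sudoku triples: the four families of classes and their intersections *)

Lemma card_ord_divn (m d q : nat) : (0 < d)%N -> (q * d + d <= m)%N ->
  #|[set x : 'I_m | x %/ d == q]%N| = d.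
Proof.
move=> d0 le; have lt (x : 'I_d) : (q * d + x < m)%N.
  by apply: leq_trans le; rewrite ltn_add2l.
rewrite -[RHS]card_ord -(card_imset predT (f := fun x : 'I_d => Ordinal (lt x))); last first.
  by move=> x y [] /eqP; rewrite eqn_add2l => /eqP /val_inj.
apply: eq_card => x; rewrite !inE; apply/eqP/imsetP => [e|[y _ ->] /=].
  exists (Ordinal (ltn_pmod x d0)) => //.
  by apply: val_inj; rewrite /= -e -divn_eq.
by rewrite divnMDl // divn_small ?addn0.
Qed.

Section SudokuTriples.
Variables (h w : nat) (P : array h w).
Hypotheses (h_gt0 : (0 < h)%N) (w_gt0 : (0 < w)%N).
Local Notation triple := ('I_(h * w) * 'I_(h * w) * 'I_(h * w))%type.
Implicit Types (t s : triple).

Lemma row_bundle_lt (i : 'I_(h * w)) : (i %/ h < w)%N.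
Proof. by rewrite ltn_divLR // [(w * h)%N]mulnC ltn_ord. Qed.

Lemma col_bundle_lt (j : 'I_(h * w)) : (j %/ w < h)%N.
Proof. by rewrite ltn_divLR ?ltn_ord. Qed.

Lemma box_lt (i j : 'I_(h * w)) : (box h w i j < h * w)%N.
Proof.
rewrite /box; apply: (@leq_trans (h * (i %/ h) + h)).
  by rewrite ltn_add2l col_bundle_lt.
by rewrite -mulnSr leq_mul2l row_bundle_lt orbT.
Qed.

Lemma eq_box (i j i' j' : 'I_(h * w)) :
  (box h w i j == box h w i' j') = (i %/ h == i' %/ h)%N && (j %/ w == j' %/ w)%N.
Proof.
apply/eqP/andP => [|[/eqP ei /eqP ej]]; last by rewrite /box ei ej.
rewrite /box [(h * (i %/ h))%N]mulnC [(h * (i' %/ h))%N]mulnC => e.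
have := congr1 (divn^~ h) e; have := congr1 (modn^~ h) e; rewrite /=.
rewrite !modnMDl !divnMDl // !modn_small ?col_bundle_lt //.
by rewrite !(divn_small (col_bundle_lt _)) !addn0 => -> ->.
Qed.

Lemma card_row_bundle (i : 'I_(h * w)) : #|[set x : 'I_(h * w) | x %/ h == i %/ h]%N| = h.
Proof.
apply: card_ord_divn => //.
by rewrite -mulSnr mulnC leq_mul2l row_bundle_lt orbT.
Qed.

Lemma card_col_bundle (j : 'I_(h * w)) : #|[set x : 'I_(h * w) | x %/ w == j %/ w]%N| = w.
Proof.
apply: card_ord_divn => //.
by rewrite -mulSnr leq_mul2r col_bundle_lt orbT.
Qed.

(** The families are, in order, cell, row-symbol, column-symbol and box-symbol. Pairs of naturals
    give all of them a common key type. *)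
Definition sudoku_key (a : 'I_4) (t : triple) : nat * nat :=
  let: (i, j, k) := t in
  match val a with
  | 0 => (i : nat, j : nat)
  | 1 => (i : nat, k : nat)
  | 2 => (j : nat, k : nat)
  | _ => (box h w i j, k : nat)
  end%N.

(** All classes, and all intersections of two classes of different families, are products of sets of
    rows, columns and symbols, or empty when the two keys are incompatible; [c] records
    compatibility. *)
Lemma card_set_if_prod (Q : pred triple) (c : bool) (X Y Z : {set 'I_(h * w)}) :
  (forall i j k, Q (i, j, k) = [&& c, i \in X, j \in Y & k \in Z]) ->
  #|[set t | Q t]| = (c * (#|X| * #|Y| * #|Z|))%N.
Proof.
move=> H; rewrite -!cardsX; case: c H => H; last first.
  by apply/eqP; rewrite cards_eq0; apply/eqP/setP => -[[i j] k]; rewrite !inE H.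
rewrite mul1n; apply: eq_card => -[[i j] k].
by rewrite !inE H /= andbA.
Qed.

Ltac solve_key_eq :=
  move=> x y z; rewrite !inE !xpair_eqE -?(inj_eq val_inj) ?eq_box /= ?andbT;
  apply/idP/idP => ?;
  repeat match goal with
  | H : is_true (_ && _) |- _ => case/andP: H => ? ?
  | H : is_true (_ == _) |- _ => move/eqP: H => H
  end;
  repeat (apply/andP; split); apply/eqP; congruence.

Lemma card_sudoku_class a t :
  #|[set t' | sudoku_key a t' == sudoku_key a t]| = (h * w)%N.
Proof.
case: t => -[i j] k; case: a => -[|[|[|[|//]]]] lt_a; rewrite /sudoku_key /=.
- rewrite (@card_set_if_prod _ true [set i] [set j] setT).
    by rewrite !cards1 cardsT card_ord !mul1n.
  by solve_key_eq.
- rewrite (@card_set_if_prod _ true [set i] setT [set k]).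
    by rewrite !cards1 cardsT card_ord !mul1n muln1.
  by solve_key_eq.
- rewrite (@card_set_if_prod _ true setT [set j] [set k]).
    by rewrite !cards1 cardsT card_ord !mul1n !muln1.
  by solve_key_eq.
- rewrite (@card_set_if_prod _ true [set x : 'I_(h * w)| x %/ h == i %/ h]%N
     [set x : 'I_(h * w) | x %/ w == j %/ w]%N [set k]).
    by rewrite card_row_bundle card_col_bundle cards1 mul1n muln1.
  by solve_key_eq.
Qed.

(** Closed form of [key_meet], meaningful for [a < b] only; in this form symmetry in [t] and [s] is
    visible. The factors [w] and [h] count the columns, respectively rows, of a box. *)
Definition sudoku_meet (a b : nat) (t s : triple) : nat :=
  let: (i, j, k) := t in let: (i', j', k') := s in
  match a, b with
  | 0, 1 => i == i'
  | 0, 2 => j == j'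
  | 0, _ => box h w i j == box h w i' j'
  | 1, 2 => k == k'
  | 1, _ => ((k == k') && (i %/ h == i' %/ h)) * w
  | _, _ => ((k == k') && (j %/ w == j' %/ w)) * h
  end%N.

Lemma key_meetE (a b : 'I_4) t s :
  (a < b)%N -> key_meet sudoku_key a b t s = sudoku_meet a b t s.
Proof.
case: t s => [[i j] k] [[i' j'] k'].
case: a b => -[|[|[|[|//]]]] Ha [] -[|[|[|[|//]]]] Hb //= _;
  rewrite /key_meet /sudoku_key /=.
- rewrite (@card_set_if_prod _ (i == i') [set i] [set j] [set k']).
    by rewrite !cards1 !muln1.
  solve_key_eq.
- rewrite (@card_set_if_prod _ (j == j') [set i] [set j] [set k']).
    by rewrite !cards1 !muln1.
  solve_key_eq.
- rewrite (@card_set_if_prod _ (box h w i j == box h w i' j') [set i] [set j] [set k']).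
    by rewrite !cards1 !muln1.
  solve_key_eq.
- rewrite (@card_set_if_prod _ (k == k') [set i] [set j'] [set k]).
    by rewrite !cards1 !muln1.
  solve_key_eq.
- rewrite (@card_set_if_prod _ ((k == k') && (i %/ h == i' %/ h)%N)
    [set i] [set x : 'I_(h * w) | x %/ w == j' %/ w]%N [set k]).
    by rewrite !cards1 card_col_bundle muln1 mul1n.
  solve_key_eq.
- rewrite (@card_set_if_prod _ ((k == k') && (j %/ w == j' %/ w)%N)
    [set x : 'I_(h * w) | x %/ h == i' %/ h]%N [set j] [set k]).
    by rewrite !cards1 card_row_bundle !muln1.
  solve_key_eq.
Qed.

Lemma sudoku_meet_sym a b t s : sudoku_meet a b t s = sudoku_meet a b s t.
Proof.
case: t s => [[i j] k] [[i' j'] k'] /=.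
by rewrite (eq_sym i) (eq_sym j) (eq_sym k) (eq_sym (box _ _ _ _))
   (eq_sym (i %/ h)%N) (eq_sym (j %/ w)%N).
Qed.

Lemma key_meet_sudoku_sym (a b : 'I_4) t s :
  key_meet sudoku_key a b t s = key_meet sudoku_key a b s t.
Proof.
case: (ltngtP a b) => [lt|lt|/val_inj ->]; last exact: key_meetC.
  by rewrite !key_meetE // sudoku_meet_sym.
by rewrite ![key_meet _ a b _ _]key_meetC !key_meetE // sudoku_meet_sym.
Qed.

(** * Filled triples and density *)

Definition filled : {set triple} := [set t | P t.1.1 t.1.2 == Some t.2].

Lemma filled_class_le1 (a : 'I_4) t : partial_sudoku P ->
  (#|[set s in filled | sudoku_key a s == sudoku_key a t]| <= 1)%N.
Proof.
case: t => [[i j] k] [rowP colP boxP].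
apply/card_le1_eqP => -[[i1 j1] k1] [[i2 j2] k2]; rewrite !inE /=.
case: a => -[|[|[|[|//]]]] lt_a; rewrite /sudoku_key /= !xpair_eqE;
  move=> /and3P [/eqP P1 e1 e2] /and3P [/eqP P2 e3 e4].
- move: e1 e2 e3 e4 P1 P2; rewrite !(inj_eq val_inj) => /eqP -> /eqP -> /eqP -> /eqP ->.
  by move=> -> [->].
- move: e1 e2 e3 e4 P1 P2; rewrite !(inj_eq val_inj) => /eqP -> /eqP -> /eqP -> /eqP -> P1 P2.
  have /card_le1_eqP /(_ j1 j2) -> := rowP i k; by rewrite ?inE ?P1 ?P2.
- move: e1 e2 e3 e4 P1 P2; rewrite !(inj_eq val_inj) => /eqP -> /eqP -> /eqP -> /eqP -> P1 P2.
  have /card_le1_eqP /(_ i1 i2) -> := colP j k; by rewrite ?inE ?P1 ?P2.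
- move: e2 e4 P1 P2; rewrite !(inj_eq val_inj) => /eqP -> /eqP -> P1 P2.
  have /card_le1_eqP box1 := boxP (Ordinal (box_lt i j)) k.
  suff [-> ->] : (i1, j1) = (i2, j2) by [].
  by apply: box1; rewrite inE /= ?P1 ?P2 ?e1 ?e3 eqxx.
Qed.

Lemma sum_filled (G : triple -> nat) :
  (\sum_(s in filled) G s =
   \sum_(c : 'I_(h * w) * 'I_(h * w)) if P c.1 c.2 is Some k then G (c, k) else 0)%N.
Proof.
rewrite [RHS](eq_bigr (fun c => \sum_(k | P c.1 c.2 == Some k) G (c, k))%N); last first.
  move=> c _; case: (P c.1 c.2) => [k|]; last by rewrite big_pred0.
  by rewrite (big_pred1 k) // => x; rewrite eq_sym.
rewrite pair_big_dep /=; apply: eq_big => [s|[c k] //].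
by rewrite inE.
Qed.

Lemma sum_filled_cells (D : pred ('I_(h * w) * 'I_(h * w))) :
  (\sum_(s in filled) D s.1 = #|[set c | D c & P c.1 c.2 != None]|)%N.
Proof.
rewrite sum_filled -sum1dep_card [RHS]big_mkcond; apply: eq_bigr => c _.
by case: (P _ _) => [k|]; rewrite ?andbT ?andbF //; case: (D c).
Qed.

Lemma sum_filled_symbol (D : pred ('I_(h * w) * 'I_(h * w))) (k : 'I_(h * w)) :
  (\sum_(s in filled) ((k == s.2) && D s.1) = #|[set c | D c & P c.1 c.2 == Some k]|)%N.
Proof.
rewrite sum_filled -sum1dep_card [RHS]big_mkcond; apply: eq_bigr => c _.
case: (P _ _) => [x|]; rewrite ?andbF // [Some x == _]eq_sym (inj_eq Some_inj) andbC.
by case: (_ && _).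
Qed.

Lemma card_row_cells (i : 'I_(h * w)) (D : rel 'I_(h * w)) :
  #|[set c : 'I_(h * w) * 'I_(h * w) | (i == c.1) && D c.1 c.2]| = #|[set j | D i j]|.
Proof.
rewrite -[RHS](card_imset _ (f := pair i)); last by move=> x y [].
apply: eq_card => -[x y]; rewrite !inE /=; apply/andP/imsetP => [[/eqP <- Dy]|[z]].
  by exists y; rewrite ?inE.
by rewrite inE => Dz [-> ->].
Qed.

Lemma card_col_cells (j : 'I_(h * w)) (D : rel 'I_(h * w)) :
  #|[set c : 'I_(h * w) * 'I_(h * w) | (j == c.2) && D c.1 c.2]| = #|[set i | D i j]|.
Proof.
rewrite -[RHS](card_imset _ (f := pair^~ j)); last by move=> x y [].
apply: eq_card => -[x y]; rewrite !inE /=; apply/andP/imsetP => [[/eqP <- Dy]|[z]].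
  by exists x; rewrite ?inE.
by rewrite inE => Dz [-> ->].
Qed.

(** Each pair of families matches one density condition: cell with row-symbol, column-symbol or
    box-symbol counts the filled cells of a row, column or box; the pairs of symbol families count
    occurrences of [k] in bundles. *)
Lemma filled_sparse (R : realType) (eps : R) (a b : 'I_4) t :
  dense_sudoku eps P -> a != b ->
  (\sum_(s in filled) key_meet sudoku_key a b t s)%:R <= eps * (h * w)%:R.
Proof.
case=> rowD colD boxD rbD cbD.
wlog lt_ab : a b / (a < b)%N => [IH|_].
  rewrite neq_ltn => /orP [lt|lt]; first by apply: IH; rewrite // neq_ltn lt.
  under eq_bigr do rewrite key_meetC -key_meet_sudoku_sym.
  by apply: IH; rewrite // neq_ltn lt.
under eq_bigr do rewrite key_meetE //.
case: t => [[i j] k].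
have rb : (\sum_(s in filled) ((k == s.2) && (i %/ h == s.1.1 %/ h)%N))%:R <= eps * h%:R.
  rewrite (sum_filled_symbol (fun c => (i %/ h == c.1 %/ h)%N)).
  apply: le_trans (rbD (Ordinal (row_bundle_lt i)) k); rewrite ler_nat subset_leq_card //.
  by apply/subsetP => c; rewrite !inE (eq_sym (i %/ h)%N).
have cb : (\sum_(s in filled) ((k == s.2) && (j %/ w == s.1.2 %/ w)%N))%:R <= eps * w%:R.
  rewrite (sum_filled_symbol (fun c => (j %/ w == c.2 %/ w)%N)).
  apply: le_trans (cbD (Ordinal (col_bundle_lt j)) k); rewrite ler_nat subset_leq_card //.
  by apply/subsetP => c; rewrite !inE (eq_sym (j %/ w)%N).
case: a b lt_ab => -[|[|[|[|//]]]] lt_a [] -[|[|[|[|//]]]] lt_b //= _.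
- apply: le_trans (rowD i); rewrite ler_nat.
  rewrite -(card_row_cells i (fun i j => P i j != None)) -sum_filled_cells.
  by apply: leq_sum => -[[]].
- apply: le_trans (colD j); rewrite ler_nat.
  rewrite -(card_col_cells j (fun i j => P i j != None)) -sum_filled_cells.
  by apply: leq_sum => -[[]].
- apply: le_trans (boxD (Ordinal (box_lt i j))); rewrite ler_nat.
  rewrite -(sum_filled_cells (fun c => box h w c.1 c.2 == box h w i j)).
  by apply: leq_sum => -[[]] * /=; rewrite eq_sym.
(* Row-symbol against column-symbol counts all occurrences of [k] in the array; splitting them over
   the [w] row bundles gives [w * (eps * h)]. *)
- rewrite (eq_bigr (fun s : triple => ((k == s.2) && true) : nat)); last first.
    by move=> [[]] *; rewrite andbT.
  rewrite (sum_filled_symbol xpredT).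
  rewrite -sum1dep_card (partition_big (fun c => Ordinal (row_bundle_lt c.1)) xpredT) //=.
  rewrite natr_sum; apply: (@le_trans _ _ (\sum_(p < w) eps * h%:R)); last first.
    by rewrite sumr_const card_ord -[leLHS]mulr_natr natrM mulrA.
  apply: ler_sum => p _; apply: le_trans (rbD p k).
  rewrite ler_nat sum1dep_card subset_leq_card //.
  by apply/subsetP => c; rewrite !inE -(inj_eq val_inj) /= andbC.
- rewrite (eq_bigr (fun s : triple =>
    ((k == s.2) && (i %/ h == s.1.1 %/ h)%N) * w)%N); last first.
    by move=> [[]].
  by rewrite -big_distrl /= !natrM mulrA ler_wpM2r.
- rewrite (eq_bigr (fun s : triple =>
    ((k == s.2) && (j %/ w == s.1.2 %/ w)%N) * h)%N); last first.
    by move=> [[]].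
  by rewrite -big_distrl /= !natrM [h%:R * w%:R]mulrC mulrA ler_wpM2r.
Qed.
End SudokuTriples.

(** * From class sums to fractional completions *)

Lemma box_surj h w (l : 'I_(h * w)) : (0 < h)%N -> (0 < w)%N ->
  exists j : 'I_(h * w), box h w l j = l.
Proof.
move=> h_gt0 w_gt0.
(* Row [l] lies in bundle [l %/ h], and column [(l %% h) * w] is the first of bundle [l %% h], so
   their box is [h * (l %/ h) + l %% h = l]. *)
have lt : ((l %% h) * w < h * w)%N by rewrite ltn_pmul2r // ltn_pmod.
by exists (Ordinal lt); rewrite /box /= mulnK // mulnC -divn_eq.
Qed.

Theorem theorem1p1 (R : realType) :
  exists h0 w0 : nat, forall h w : nat,
    (2 <= h)%N -> (2 <= w)%N -> (h0 <= h)%N -> (w0 <= w)%N ->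
    forall P : array h w,
      partial_sudoku P -> dense_sudoku (1 / 101%:R : R) P ->
      exists f : 'I_(h * w) -> 'I_(h * w) -> 'I_(h * w) -> R,
        fractional_completion P f.
Proof.
(* The smallness condition on [eps] does not involve [h] and [w], so the thresholds can be 0. *)
exists 0%N, 0%N => h w h2 w2 _ _ P sudP denseP.
have h_gt0 : (0 < h)%N by apply: ltn_trans h2.
have w_gt0 : (0 < w)%N by apply: ltn_trans w2.
have n_gt0 : (0 < h * w)%N by rewrite muln_gt0 h_gt0.
have [|||f [f0 f1 fS]] := @fractional_cover R _ _ _ (@sudoku_key h w) (h * w) (filled P)
  (1 / 101%:R) n_gt0 (card_sudoku_class h_gt0 w_gt0)
  (key_meet_sudoku_sym h_gt0 w_gt0)
  (fun a t => filled_class_le1 h_gt0 w_gt0 a t sudP)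
  (fun a b t => filled_sparse h_gt0 w_gt0 t denseP).
- by rewrite card_ord.
- by rewrite divr_ge0 ?ler0n.
(* The condition reads [2 * 15 * 3 / 101 = 90 / 101 <= 1]. *)
- by rewrite card_ord (_ : 2 ^ 4 = 16)%N // (_ : 4.-1 = 3)%N //; lra.
have f_le1 t : f t <= 1.
  rewrite -(fS ord0 t) (bigD1 t) //= lerDl.
  by apply: sumr_ge0 => s _; apply: f0.
exists (fun i j k => f (i, j, k)); split.
- by move=> i j k; rewrite f0 f_le1.
- by move=> i j k Pijk; apply: f1; rewrite inE.
- split=> [j k|i k|i j].
  (* The first coordinate of the representative is arbitrary, since family 2 ignores rows; the other
     two sums use similar fillers. *)
  + rewrite -(fS (@Ordinal 4 2 isT) (j, j, k)).
    rewrite [RHS](reindex_onto (fun i => (i, j, k)) (fun t => t.1.1)) /=; last first.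
      by case=> -[x y] z; rewrite xpair_eqE !(inj_eq val_inj) => /andP [/eqP -> /eqP ->].
    by apply: eq_bigl => x; rewrite !eqxx.
  + rewrite -(fS (@Ordinal 4 1 isT) (i, i, k)).
    rewrite [RHS](reindex_onto (fun j => (i, j, k)) (fun t => t.1.2)) /=; last first.
      by case=> -[x y] z; rewrite xpair_eqE !(inj_eq val_inj) => /andP [/eqP -> /eqP ->].
    by apply: eq_bigl => x; rewrite !eqxx.
  + rewrite -(fS (@Ordinal 4 0 isT) (i, j, i)).
    rewrite [RHS](reindex_onto (fun k => (i, j, k)) (fun t => t.2)) /=; last first.
      by case=> -[x y] z; rewrite xpair_eqE !(inj_eq val_inj) => /andP [/eqP -> /eqP ->].
    by apply: eq_bigl => x; rewrite !eqxx.
- move=> l k; have [j lj] := box_surj l h_gt0 w_gt0.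
  rewrite -(fS (@Ordinal 4 3 isT) (l, j, k)).
  rewrite [RHS](reindex_onto (fun c => (c, k)) fst) /=; last first.
    by case=> -[x y] z; rewrite xpair_eqE !(inj_eq val_inj) => /andP [_ /eqP ->].
  by apply: eq_big => [[x y]|[x y]]; rewrite ?lj /sudoku_key /= ?xpair_eqE ?lj ?eqxx ?andbT.
Qed.
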